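(* Let $d\ge 2$, let $\mathcal{H}$ be a $d$-dimensional complex Hilbert space, and let $\mathbb{P}=\{\mathcal{P}^{(1)},\ldots,\mathcal{P}^{(M)}\}$ be a set of $M$ mutually unbiased measurements of efficiency $\varkappa$ on $\mathcal{H}$. Then for every density matrix $\rho$ on $\mathcal{H}$, the sum of the indices of coincidence satisfies $$\sum_{\mathcal{P}\in\mathbb{P}}C(\mathcal{P}|\rho)\;\leq\;\frac{M-1}{d}+\frac{1-\varkappa+(\varkappa d-1)\,\mathrm{Tr}(\rho^{2})}{d-1}.$$
   Context: A density matrix on $\mathcal{H}$ is a positive semidefinite operator $\rho$ with $\mathrm{Tr}(\rho)=1$. A POVM with $d$ elements is a family of positive semidefinite operators $\{P_n\}_{n=1}^d$ on $\mathcal{H}$ with $\sum_n P_n=I$ (the identity). A set $\mathbb{P}=\{\mathcal{P}^{(1)},\ldots,\mathcal{P}^{(M)}\}$ of POVMs $\mathcal{P}^{(b)}=\{P^{(b)}_n\}_{n=1}^d$, each with $d$ elements (an indexed family, $b=1,\dots,M$), is a set of $M$ mutually unbiased measurements (MUMs) of efficiency $\varkappa$ if: (i) $\mathrm{Tr}(P^{(b)}_n)=1$ for all $b,n$; (ii) $\mathrm{Tr}(P^{(a)}_mP^{(b)}_n)=\frac1d$ for all $a\neq b$ and all $m,n$; (iii) for all $b,m,n$, $\mathrm{Tr}(P^{(b)}_mP^{(b)}_n)=\delta_{mn}\,\varkappa+(1-\delta_{mn})\frac{1-\varkappa}{d-1}$. Here $\varkappa$ is a real parameter, for which $1/d\le\varkappa\le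 1$. Sums over $\mathcal{P}\in\mathbb{P}$ mean sums over $b=1,\dots,M$. For a POVM $\mathcal{P}=\{P_n\}_{n=1}^d$ and density matrix $\rho$, the outcome probabilities are $p_n(\mathcal{P}|\rho)=\mathrm{Tr}(P_n\rho)$ and the index of coincidence is $C(\mathcal{P}|\rho)=\sum_{n=1}^d p_n(\mathcal{P}|\rho)^2$. *)

(* Defs.v *)
(* Operators on the d-dimensional complex Hilbert space are
   d x d matrices over R[i] in an orthonormal basis, with R : realType.
   The order on R[i] is the library's: x <= y means that y - x is real and
   nonnegative, so inequalities between traces also assert that the
   difference of the two sides is real. *)
From HB Require Import structures.
From mathcomp Require Import all_boot all_order all_algebra.
From mathcomp Require Import sesquilinear spectral.
From mathcomp Require Import reals complex.

Set Implicit Arguments.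
Unset Strict Implicit.
Unset Printing Implicit Defensive.

Import Order.TTheory GRing.Theory Num.Theory.
Local Open Scope ring_scope.
Local Open Scope complex_scope.
Local Open Scope sesquilinear_scope.

Section Quantum.
Variables (R : realType) (d : nat).
Implicit Types (A rho : 'M[R[i]]_d) (P : 'I_d -> 'M[R[i]]_d).

Definition psd A : Prop :=
  A \is hermsymmx /\ forall v : 'cV[R[i]]_d, 0 <= (v^t* *m A *m v) 0 0.

Definition density_matrix rho : Prop := psd rho /\ \tr rho = 1.

Definition povm P : Prop :=
  (forall n, psd (P n)) /\ \sum_n P n = 1%:M.

(* The bounds on kappa follow from the other clauses when 0 < M, but not for
   the empty family. *)
Record mums (M : nat) (PP : 'I_M -> 'I_d -> 'M[R[i]]_d) (kappa : R) : Prop :=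
  Mums {
    mums_kappa : d%:R^-1 <= kappa <= 1;
    mums_povm : forall b, povm (PP b);
    mums_tr1 : forall b n, \tr (PP b n) = 1;
    mums_unbiased : forall a b m n, a != b ->
      \tr (PP a m *m PP b n) = d%:R^-1;
    mums_efficiency : forall b m n,
      \tr (PP b m *m PP b n) =
        ((m == n)%:R * kappa
         + (1 - (m == n)%:R) * ((1 - kappa) / (d%:R - 1)))%:C
  }.

Definition outcome_prob P rho (n : 'I_d) : R[i] := \tr (P n *m rho).

Definition index_of_coincidence P rho : R[i] :=
  \sum_n outcome_prob P rho n ^+ 2.

End Quantum.

(* Main.v *)
(* Subtract I/d from every effect and from the state: X_(b,n) = P^(b)_n - I/d
   and H = rho - I/d.  Different measurements become orthogonal in the
   Hilbert-Schmidt product, and within one measurement the Gram matrix of the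
   X_(b,n) is g * (delta_mn - 1/d) with g = (kappa d - 1)/(d - 1).  The
   coefficients tr(X_(b,n) H) sum to zero in n, hence form an eigenvector, for
   the eigenvalue g, of the Gram matrix of the whole family, and a Bessel
   inequality bounds the sum of their squares by
   g * tr(H^2) = g * (tr(rho^2) - 1/d). *)
Require Import Defs.
From HB Require Import structures.
From mathcomp Require Import all_boot all_order all_algebra.
From mathcomp Require Import sesquilinear spectral.
From mathcomp Require Import reals complex.
From mathcomp Require Import ring.

Set Implicit Arguments.
Unset Strict Implicit.
Unset Printing Implicit Defensive.

Import Order.TTheory GRing.Theory Num.Theory.
Local Open Scope ring_scope.
Local Open Scope complex_scope.

Section HermitianMatrices.
Variables (C : numClosedFieldType) (n : nat).
Implicit Types A B : 'M[C]_n.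

Lemma hermsymmxP A :
  reflect (forall i j, (A j i)^* = A i j)%R (A \is hermsymmx).
Proof.
apply: (iffP (is_hermitianmxP _ _ _)) => [AE i j|AE].
  by rewrite [in RHS]AE expr0 scale1r !mxE.
by apply/matrixP => i j; rewrite expr0 scale1r !mxE AE.
Qed.

Lemma hermsymmxB A B :
  A \is hermsymmx -> B \is hermsymmx -> A - B \is hermsymmx.
Proof.
move=> /hermsymmxP hA /hermsymmxP hB; apply/hermsymmxP => i j.
by rewrite !mxE rmorphB /= hA hB.
Qed.

Lemma hermsymmxZ (a : C) A :
  a \is Num.real -> A \is hermsymmx -> a *: A \is hermsymmx.
Proof.
move=> ra /hermsymmxP hA; apply/hermsymmxP => i j.
by rewrite !mxE rmorphM /= hA (conj_Creal ra).
Qed.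

Lemma hermsymmx_sum (I : finType) (F : I -> 'M[C]_n) :
  (forall i, F i \is hermsymmx) -> \sum_i F i \is hermsymmx.
Proof.
move=> hF; apply/hermsymmxP => i j; rewrite !summxE rmorph_sum.
by apply: eq_bigr => k _; apply: (hermsymmxP _ (hF k)).
Qed.

(** Since [A j i] is the conjugate of [A i j], the diagonal of the square collects squared moduli.
    Positivity and definiteness of the Hilbert-Schmidt form follow from this. *)
Lemma mxtrace_hermsymmx_sqr A :
  A \is hermsymmx -> \tr (A *m A) = \sum_i \sum_j `|A i j| ^+ 2.
Proof.
move=> /hermsymmxP hA; apply: eq_bigr => i _; rewrite mxE.
by apply: eq_bigr => j _; rewrite normCK hA.
Qed.

Lemma mxtrace_hermsymmx_sqr_ge0 A : A \is hermsymmx -> 0 <= \tr (A *m A).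
Proof.
move=> hA; rewrite mxtrace_hermsymmx_sqr //.
by apply: sumr_ge0 => i _; apply: sumr_ge0 => j _; rewrite exprn_ge0.
Qed.

Lemma mxtrace_hermsymmx_sqr_eq0 A :
  A \is hermsymmx -> \tr (A *m A) = 0 -> A = 0.
Proof.
move=> hA; rewrite mxtrace_hermsymmx_sqr // => A0.
have sq_ge0 i j : 0 <= `|A i j| ^+ 2 by rewrite exprn_ge0.
apply/matrixP => i j; rewrite mxE; apply/eqP.
rewrite -normr_eq0 -sqrf_eq0; apply/eqP.
have rows0 := psumr_eq0P (fun i _ => sumr_ge0 _ (fun j _ => sq_ge0 i j)) A0.
exact: psumr_eq0P (fun j _ => sq_ge0 i j) (rows0 i isT) j isT.
Qed.

(** Conjugation reverses the product and cyclicity of the trace restores it. Real coefficients are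
    what make the combination [S] below Hermitian. *)
Lemma mxtrace_hermsymmx_mul_real A B :
  A \is hermsymmx -> B \is hermsymmx -> \tr (A *m B) \is Num.real.
Proof.
move=> /hermsymmxP hA /hermsymmxP hB; apply/CrealP.
rewrite [in RHS]mxtrace_mulC rmorph_sum; apply: eq_bigr => i _.
rewrite !mxE rmorph_sum; apply: eq_bigr => j _.
by rewrite rmorphM /= hA hB mulrC.
Qed.

(* The eigenvector hypothesis makes tr(S^2) = g * tr(S H) for
   S = \sum_i tr(X_i H) X_i; expand tr((g H - S)^2) >= 0. *)
Lemma bessel_mxtrace (I : finType) (X : I -> 'M[C]_n) H (g : C) :
    0 <= g -> H \is hermsymmx -> (forall i, X i \is hermsymmx) ->
    (forall i, \sum_j \tr (X j *m H) * \tr (X j *m X i) = g * \tr (X i *m H)) ->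
  \sum_i \tr (X i *m H) ^+ 2 <= g * \tr (H *m H).
Proof.
move=> g_ge0 hH hX gram.
pose S := \sum_i \tr (X i *m H) *: X i.
have trS A : \tr (S *m A) = \sum_i \tr (X i *m H) * \tr (X i *m A).
  rewrite mulmx_suml raddf_sum; apply: eq_bigr => i _ /=.
  by rewrite -scalemxAl mxtraceZ.
have trSH : \tr (S *m H) = \sum_i \tr (X i *m H) ^+ 2 by rewrite trS.
have trSS : \tr (S *m S) = g * \tr (S *m H).
  rewrite trSH mulr_sumr {2}/S mulmx_sumr raddf_sum; apply: eq_bigr => i _ /=.
  by rewrite -scalemxAr mxtraceZ trS gram expr2 mulrCA.
have hS : S \is hermsymmx.
  by apply: hermsymmx_sum => i; rewrite hermsymmxZ ?mxtrace_hermsymmx_mul_real.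
(* The expansion yields the bound multiplied by [g], so [g = 0] is separate: there tr(S^2) = 0
   forces [S = 0]. *)
rewrite -trSH; move: g_ge0; rewrite le0r => /predU1P[g0|g_gt0].
  rewrite (mxtrace_hermsymmx_sqr_eq0 hS) ?trSS ?g0 ?mul0r //.
  by rewrite mul0mx mxtrace0.
have := mxtrace_hermsymmx_sqr_ge0 (hermsymmxB (hermsymmxZ (gtr0_real g_gt0) hH) hS).
rewrite mulmxBl !mulmxBr -!scalemxAl -!scalemxAr !raddfB /= !mxtraceZ.
(* The S^2 term cancels one of the two cross terms, leaving g * (g * tr(H^2) - tr(S H)). *)
rewrite trSS (mxtrace_mulC H S) opprK addNr addr0 -mulrBr pmulr_rge0 //.
by rewrite subr_ge0.
Qed.

End HermitianMatrices.

Theorem proposition2 (R : realType) (d M : nat)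
    (PP : 'I_M -> 'I_d -> 'M[R[i]]_d) (kappa : R) :
  (2 <= d)%N ->
  mums PP kappa ->
  forall rho : 'M[R[i]]_d, density_matrix rho ->
  \sum_(b < M) index_of_coincidence (PP b) rho <=
    (M%:R - 1) / d%:R
    + (1 - kappa%:C + (kappa%:C * d%:R - 1) * \tr (rho *m rho)) / (d%:R - 1).
Proof.
move=> d_ge2 [/andP[kappa_ge _] povmPP tr1 unb eff] rho [[hrho _] trrho].
set K := kappa%:C; set D : R[i] := d%:R.
have D_gt0 : 0 < D by rewrite ltr0n ltnW.
have D1_gt0 : 0 < D - 1 by rewrite subr_gt0 ltr1n.
have D0 := lt0r_neq0 D_gt0; have D10 := lt0r_neq0 D1_gt0.
pose g := (K * D - 1) / (D - 1).
(* This is the bound 1/d <= kappa, carried from [R] to [R[i]]. *)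
have g_ge0 : 0 <= g.
  apply: divr_ge0 (ltW D1_gt0); rewrite subr_ge0 -ler_pdivrMr // div1r.
  have -> : D^-1 = (d%:R^-1 : R)%:C by rewrite fmorphV rmorph_nat.
  by rewrite lecR.
have herm_scalar : ((D^-1)%:M : 'M[R[i]]_d) \is hermsymmx.
  rewrite -[_%:M]scalemx1 hermsymmxZ ?hermitian1mx_subproof //.
  by rewrite realE invr_ge0 ltW.
pose X (p : 'I_M * 'I_d) := PP p.1 p.2 - (D^-1)%:M.
pose H := rho - (D^-1)%:M.
(* Each cross term contributes -1/d and tr(I/d^2) = 1/d. *)
have tr_centered (A B : 'M[R[i]]_d) : \tr A = 1 -> \tr B = 1 ->
    \tr ((A - (D^-1)%:M) *m (B - (D^-1)%:M)) = \tr (A *m B) - D^-1.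
  move=> trA trB; rewrite mulmxBl !mulmxBr !mul_mx_scalar !mul_scalar_mx.
  rewrite !raddfB /= !mxtraceZ trA trB mxtrace_scalar -mulr_natr -/D.
  by rewrite mulVf // !mulr1 opprK addNr addr0.
have XH p : \tr (X p *m H) = outcome_prob (PP p.1) rho p.2 - D^-1.
  exact: tr_centered.
have XX p q : \tr (X p *m X q) =
    (p.1 == q.1)%:R * (g * ((p.2 == q.2)%:R - D^-1)).
  case: p q => [a m] [b n]; rewrite tr_centered //=.
  have [<-|neq_ab] := eqVneq a b; last by rewrite unb // subrr mul0r.
  (* The two cases are kappa - 1/d = g * (1 - 1/d) and (1 - kappa)/(d - 1) - 1/d = -g/d. *)
  rewrite eff -/K mul1r /g; case: (m == n); rewrite /= ?mulr1n ?mulr0n.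
    by rewrite subrr mul0r addr0 mul1r -/K; field; rewrite D0.
  rewrite mul0r subr0 mul1r add0r sub0r rmorphM fmorphV !rmorphB /= rmorph1.
  by rewrite rmorph_nat -/K -/D; field; rewrite D0.
have prob_sum b : \sum_n outcome_prob (PP b) rho n = 1.
  by rewrite -raddf_sum -mulmx_suml (povmPP b).2 mul1mx.
have dD : \sum_(n < d) D^-1 = 1.
  by rewrite sumr_const card_ord -mulr_natr mulVf.
have coef_sum b : \sum_n \tr (X (b, n) *m H) = 0.
  by under eq_bigr do rewrite XH; rewrite sumrB /= prob_sum dD subrr.
have /(bessel_mxtrace g_ge0) bessel : H \is hermsymmx by exact: hermsymmxB.
have {}bessel : \sum_p \tr (X p *m H) ^+ 2 <= g * (\tr (rho *m rho) - D^-1).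
  rewrite -[_ - D^-1]tr_centered //; apply: bessel => [p|[b n]].
    by apply: hermsymmxB => //; case: (povmPP p.1) => /(_ p.2)[].
  (* Only the block [a = b] survives; in it the constant -1/d meets [coef_sum] and vanishes, so the
     Kronecker delta leaves the single term [m = n]. *)
  rewrite -(pair_bigA _ (fun a m =>
    \tr (X (a, m) *m H) * \tr (X (a, m) *m X (b, n)))) /=.
  rewrite (bigD1 b) //= [X in _ + X]big1 ?addr0 => [|a neq_ab]; last first.
    by apply: big1 => m _; rewrite XX /= (negPf neq_ab) mul0r mulr0.
  under eq_bigr do rewrite XX /= eqxx mul1r mulrCA mulrBr.
  rewrite -mulr_sumr sumrB -mulr_suml coef_sum mul0r subr0.
  rewrite (bigD1 n) //= eqxx mulr1 big1 ?addr0 // => m /negPf neq_mn.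
  by rewrite neq_mn mulr0.
have coincidence b :
    index_of_coincidence (PP b) rho = \sum_n \tr (X (b, n) *m H) ^+ 2 + D^-1.
  rewrite /index_of_coincidence.
  (* Spreading 1/d over [n] in this way turns the claim into the termwise identity p^2 = (p - 1/d)^2
     + (2p - 1/d)/d. *)
  have -> : D^-1 = \sum_n (D^-1 * (2 * outcome_prob (PP b) rho n - D^-1)).
    by rewrite -mulr_sumr sumrB -mulr_sumr prob_sum dD; ring.
  rewrite -big_split; apply: eq_bigr => n _ /=.
  by rewrite XH /=; ring.
under eq_bigr do rewrite coincidence.
rewrite big_split sumr_const card_ord -mulr_natr /= pair_bigA /=.
under eq_bigr do rewrite -surjective_pairing.
(* Once M/d is moved to the right, the Bessel bound equals the claimed one, because (1 - kappa)/(d -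
   1) - 1/d = -g/d. *)
rewrite -lerBrDr; apply: le_trans bessel _; rewrite le_eqVlt; apply/orP; left.
by apply/eqP; rewrite /g; field; rewrite D0.
Qed.
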